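(* Let $n,k$ be given positive integers with $1\le k\le n-2$, and let $\overrightarrow{G}\in\Omega(n,k)$. Then: (i) $$\rho(\overrightarrow{G})\le \frac{n-2+\sqrt{(n-2)^2+4k}}{2},$$ with equality if and only if $\overrightarrow{G}\cong\overrightarrow{K}(n,k,1)$ or $\overrightarrow{G}\cong\overrightarrow{K}(n,k,n-k-1)$. (ii) $$q(\overrightarrow{G})\le \frac{2n+k-3+\sqrt{(2n-k-3)^2+4k}}{2},$$ with equality if and only if $\overrightarrow{G}\cong\overrightarrow{K}(n,k,n-k-1)$. (iii) $$\rho^{\mathcal D}(\overrightarrow{G})\ge \frac{n-2+\sqrt{(n+2)^2-4k-8}}{2},$$ with equality if and only if $\overrightarrow{G}\cong\overrightarrow{K}(n,k,1)$ or $\overrightarrow{G}\cong\overrightarrow{K}(n,k,n-k-1)$. (iv) $$q^{\mathcal D}(\overrightarrow{G})\ge \frac{3n-3+\sqrt{(n+3)^2-8k-16}}{2},$$ with equality if and only if $\overrightarrow{G}\cong\overrightarrow{K}(n,k,1)$.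
   Context: Digraphs are finite and simple (no loops, no multiple arcs; a pair of opposite arcs is allowed). The spectral radius of a matrix is the largest modulus of its eigenvalues. For a strongly connected digraph $\overrightarrow{G}$ with vertices $v_1,\dots,v_n$: $A(\overrightarrow G)$ is the adjacency matrix ($a_{ij}=1$ if $(v_i,v_j)$ is an arc, else $0$) and $\rho(\overrightarrow G)$ is its spectral radius; $Q(\overrightarrow G)=\mathrm{diag}(d_1^+,\dots,d_n^+)+A(\overrightarrow G)$, with $d_i^+$ the outdegree of $v_i$, is the signless Laplacian matrix and $q(\overrightarrow G)$ is its spectral radius; $\mathcal D(\overrightarrow G)$ is the distance matrix, whose $(i,j)$ entry is the length of a shortest directed path from $v_i$ to $v_j$, and $\rho^{\mathcal D}(\overrightarrow G)$ is its spectral radius; $Tr(\overrightarrow G)$ is the diagonal matrix of row sums of $\mathcal D(\overrightarrow G)$; $\mathcal Q(\overrightarrow G)=Tr(\overrightarrow G)+\mathcal D(\overrightarrow G)$ is the distance signless Laplacian matrix and $q^{\mathcal D}(\overrightarrow G)$ is its spectral radius. The vertex connectivity $\kappa(\overrightarrow G)$ of a strongly connected digraph is the minimum number of vertices whose deletion makes the digraph not strongly connected (for the complete digraph on $n$ vertices it is $n-1$). $\Omega(n,k)$ is the set of all simple strongly connected digraphs on $n$ vertices with vertex connectivity $k$. For $1\le k\le n-2$ and $1\le p\le n-k-1$, $\overrightarrow K(n,k,p)$ is the digraph whose vertex set is a disjoint union of sets $P,S,R$ with $|P|=p$, $|S|=k$, $|R|=n-p-k$, and whose arcs are all ordered pairs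 $(u,v)$ of distinct vertices except those with $u\in R$ and $v\in P$. *)

(* Defs.v *)
From mathcomp Require Import all_boot all_order all_algebra.
From mathcomp Require Import classical_sets reals.
From mathcomp.real_closed Require Import complex.

Set Implicit Arguments.
Unset Strict Implicit.
Unset Printing Implicit Defensive.

Import Order.TTheory GRing.Theory Num.Theory.

Local Open Scope ring_scope.
Local Open Scope complex_scope.

Record digraph (V : finType) := Digraph {
  arc :> rel V;
  arc_irrefl : irreflexive arc
}.

Definition digraph_iso (V W : finType) (G : digraph V) (H : digraph W) : Prop :=
  exists2 f : V -> W, bijective f & forall u v, H (f u) (f v) = G u v.

Section Digraphs.
Variables (V : finType) (G : digraph V).

Definition strongly_connected : bool := [forall u, forall v, connect G u v].

Definition complete_digraph : bool :=
  [forall u, forall v, (u != v) ==> G u v].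

Definition induced_rel (A : {set V}) : rel {x : V | x \in A} :=
  fun x y => G (val x) (val y).

Lemma induced_irrefl (A : {set V}) : irreflexive (induced_rel (A := A)).
Proof. by move=> x; apply: arc_irrefl. Qed.

Definition induced (A : {set V}) : digraph {x : V | x \in A} :=
  Digraph (@induced_irrefl A).

Definition outdegree (u : V) : nat := #|[set v | G u v]|.

(* The length of a walk from u is the size of the ssreflect path p. Only
   lengths m < #|V| need to be considered; unreachable pairs get the junk
   value #|V|. See distanceP. *)
Definition distance (u v : V) : nat :=
  \big[minn/#|V|]_(m < #|V| | [exists p : m.-tuple V,
                                 path G u p && (last u p == v)]) m.

End Digraphs.

(* Deleting all vertices leaves the empty digraph, which counts as strongly
   connected here, as does a digraph with a single vertex. If G is not
   complete then the minimum is over a nonempty family, so that the default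
   #|V| plays no role: see vertex_connectivityP. *)
Definition vertex_connectivity (V : finType) (G : digraph V) : nat :=
  if complete_digraph G then #|V|.-1
  else \big[minn/#|V|]_(S : {set V} |
         ~~ strongly_connected (induced G (~: S))) #|S|.

Definition Omega (n k : nat) : pred (digraph 'I_n) :=
  fun G => strongly_connected G && (vertex_connectivity G == k).

Section K.
Variables n k p : nat.

(* The three summands are P, S and R, in this order. *)
Definition K_vertex : finType := ('I_p + 'I_k + 'I_(n - p - k))%type.

Definition K_in_P (x : K_vertex) : bool :=
  if x is inl (inl _) then true else false.
Definition K_in_R (x : K_vertex) : bool :=
  if x is inr _ then true else false.

Definition K_rel : rel K_vertex :=
  fun u v => (u != v) && ~~ (K_in_R u && K_in_P v).

Lemma K_irrefl : irreflexive K_rel.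
Proof. by move=> u; rewrite /K_rel eqxx. Qed.

Definition K : digraph K_vertex := Digraph K_irrefl.

End K.

(* Eigenvalues are complex; see spectral_radius_max for the fact that this
   supremum is a maximum. *)
Definition spectral_radius (R : realType) (n : nat) (A : 'M[R]_n) : R :=
  sup [set r : R | exists2 z : R[i],
         eigenvalue (map_mx (real_complex R) A) z & r = complex.Re `|z|]%classic.

Section Matrices.
Variables (R : realType) (n : nat) (G : digraph 'I_n).

Definition adjacency_mx : 'M[R]_n := \matrix_(i, j) (G i j)%:R.

Definition signless_laplacian_mx : 'M[R]_n :=
  diag_mx (\row_i (outdegree G i)%:R) + adjacency_mx.

Definition distance_mx : 'M[R]_n := \matrix_(i, j) (distance G i j)%:R.

Definition transmission_mx : 'M[R]_n :=
  diag_mx (\row_i \sum_j distance_mx i j).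

Definition distance_signless_laplacian_mx : 'M[R]_n :=
  transmission_mx + distance_mx.

Definition rho : R := spectral_radius adjacency_mx.
Definition q : R := spectral_radius signless_laplacian_mx.
Definition rhoD : R := spectral_radius distance_mx.
Definition qD : R := spectral_radius distance_signless_laplacian_mx.

End Matrices.

Lemma bigminn_le (I : finType) (P : pred I) (F : I -> nat) m i :
  P i -> (\big[minn/m]_(j | P j) F j <= F i)%N.
Proof.
move=> Pi; elim: (index_enum I) (mem_index_enum i) => // j s IH.
rewrite in_cons big_cons => /predU1P[<-|/IH le_s]; first by rewrite Pi geq_minl.
by case: (P j) => //; apply: leq_trans (geq_minr _ _) le_s.
Qed.

Lemma bigminn_attained (I : finType) (P : pred I) (F : I -> nat) m :
  let b := \big[minn/m]_(j | P j) F j in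
  b = m \/ exists2 i, P i & F i = b.
Proof.
move=> b; rewrite {}/b; elim/big_rec: _ => [|i x Pi IH]; first by left.
case: (leqP (F i) x) => _; last by [].
by right; exists i.
Qed.

Lemma vertex_connectivityP (V : finType) (G : digraph V) :
  ~~ complete_digraph G ->
  let cut S := ~~ strongly_connected (induced G (~: S)) in
  (exists2 S, cut S & #|S| = vertex_connectivity G) /\
  (forall S, cut S -> (vertex_connectivity G <= #|S|)%N).
Proof.
move=> ncG cut; rewrite /vertex_connectivity (negbTE ncG).
have le_cut S : cut S ->
    (\big[minn/#|V|]_(T : {set V} | cut T) #|T| <= #|S|)%N.
  exact: (@bigminn_le _ _ (fun T : {set V} => #|T|)).
split=> //; case/forallPn: ncG => u /forallPn[v]; rewrite negb_imply.
case/andP=> uv nGuv; set S := ~: [set u; v].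
have cutS : cut S.
  have uS : u \in ~: S by rewrite finset.setCK !inE eqxx.
  have vS : v \in ~: S by rewrite finset.setCK !inE eqxx orbT.
  have memS w : w \in ~: S -> (w == u) || (w == v).
    by rewrite finset.setCK !inE.
  apply/forallPn; exists (Sub u uS); apply/forallPn; exists (Sub v vS).
  apply/negP => /connectP[p].
  elim: p => [_ /(congr1 val)/= vu|x p IH /= /andP[ux xp] px].
    by rewrite vu eqxx in uv.
  have xE : x = Sub u uS; last by rewrite xE in xp px; apply: IH.
  apply: val_inj => /=; move: ux; rewrite /induced_rel /=.
  by case/orP: (memS _ (valP x)) => /eqP-> // Guv; rewrite Guv in nGuv.
have [bE|//] := @bigminn_attained _ cut (fun T : {set V} => #|T|) #|V|.
have := le_cut S cutS; rewrite bE.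
by rewrite leqNgt -(finset.cardsC S) finset.setCK cards2 uv addn2 ltnW.
Qed.

Lemma distanceP (V : finType) (G : digraph V) (u v : V) :
  connect G u v ->
  (exists p, [/\ path G u p, last u p = v & size p = distance G u v]) /\
  (forall p, path G u p -> last u p = v -> (distance G u v <= size p)%N).
Proof.
have min p : path G u p -> last u p = v ->
    (distance G u v <= size p)%N /\ (distance G u v < #|V|)%N.
  move=> up pv; case/shortenP: up pv => p' up' uniq_p' sub_p' pv.
  have lt_p' : (size p' < #|V|)%N.
    by have := max_card (mem (u :: p')); rewrite (card_uniqP uniq_p').
  have le_d : (distance G u v <= size p')%N.
    apply: (@bigminn_le _ _ (fun m : 'I_#|V| => m : nat) _ (Ordinal lt_p')).
    by apply/existsP; exists (in_tuple p'); rewrite /= up' pv eqxx.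
  split; last exact: leq_ltn_trans le_d lt_p'.
  apply: leq_trans le_d (uniq_leq_size _ sub_p').
  by case/andP: uniq_p'.
move=> /connectP[p0 up0 v0]; split=> [|p up pv]; last by case: (min p up pv).
have [_] := min p0 up0 (esym v0).
case: (@bigminn_attained _ (fun m : 'I_#|V| => [exists p : m.-tuple V,
    path G u p && (last u p == v)]) (fun m : 'I_#|V| => m : nat) #|V|).
  by rewrite /distance => ->; rewrite ltnn.
case=> m /existsP[p /andP[up /eqP pv]] mE _.
by exists p; split=> //; rewrite size_tuple.
Qed.

Lemma spectral_radius_max (R : realType) (n : nat) (A : 'M[R]_n) :
  (0 < n)%N ->
  let eig := eigenvalue (map_mx (real_complex R) A) in
  (exists2 z, eig z & spectral_radius A = complex.Re `|z|) /\
  (forall z, eig z -> complex.Re `|z| <= spectral_radius A).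
Proof.
move=> n0 /=; set B := map_mx _ A; set eig := eigenvalue B.
have [rs Brs] := closed_field_poly_normal (char_poly B).
rewrite (monicP (char_poly_monic B)) scale1r in Brs.
have eigE z : eig z = (z \in rs).
  by rewrite /eig eigenvalue_root_char Brs root_prod_XsubC.
have rs_n0 : (0 < size rs)%N.
  have := size_char_poly B; rewrite Brs size_prod_XsubC => -[->].
  exact: n0.
have [z zrs zmax] : exists2 z, z \in rs &
    forall w, w \in rs -> complex.Re `|w| <= complex.Re `|z|.
  case: rs rs_n0 {Brs eigE} => // a s _; elim: s => [|b s [z zs zmax]].
    by exists a => [|w]; rewrite ?mem_head // inE => /eqP->.
  have mem w : (w \in a :: b :: s) = (w == b) || (w \in a :: s).
    by rewrite !inE orbCA.
  have [le_bz|lt_zb] := leP (complex.Re `|b|) (complex.Re `|z|).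
    by exists z => [|w]; rewrite mem ?zs ?orbT // => /predU1P[->|/zmax].
  exists b => [|w]; rewrite mem ?eqxx // => /predU1P[-> //|/zmax le_wz].
  exact: le_trans le_wz (ltW lt_zb).
set E := [set r : R | exists2 w : R[i], eig w & r = complex.Re `|w|]%classic.
have zE : E (complex.Re `|z|) by exists z; rewrite ?eigE.
have ubE : ubound E (complex.Re `|z|).
  by move=> _ [w + ->]; rewrite eigE => /zmax.
have srE : spectral_radius A = complex.Re `|z|.
  apply/eqP; rewrite eq_le; apply/andP; split.
    by apply: ge_sup => //; exists (complex.Re `|z|).
  by apply: ub_le_sup => //; exists (complex.Re `|z|).
split; first by exists z; rewrite ?eigE.
by move=> w; rewrite eigE srE => /zmax.
Qed.

(* Main.v *)
(* A minimum vertex cut of size k of G, together with the set Q of the vertices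
   reachable from some vertex once the cut is deleted, exhibits G as a spanning
   subdigraph of K(n, k, p): no arc goes from Q to the remaining set P. Hence
   the matrices A, Q of G are entrywise below those of K(n, k, p), and the
   distance matrices are entrywise above. All comparisons use one explicit
   positive vector x, constant on Q and off Q and built from the claimed extremal
   value l: for the matrix N of K(n, k, p), N x - l x vanishes off Q, and on Q it
   is a constant which has a fixed sign and vanishes exactly for the extremal p.
   Two Perron-Frobenius bounds conclude: for B >= 0 and x > 0, B x <= l x implies
   that the spectral radius is at most l, and B x >= l x that it is at least l,
   with equality only if B x = l x (when B is irreducible, respectively positive
   off the diagonal). *)

Require Import Defs.
From mathcomp Require Import all_boot all_order all_algebra.
From mathcomp Require Import reals.
From mathcomp.real_closed Require Import complex polyrcf.
From mathcomp Require Import ring lra zify.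

Import Order.TTheory GRing.Theory Num.Theory.

Local Open Scope ring_scope.

Set Implicit Arguments.
Unset Strict Implicit.
Unset Printing Implicit Defensive.

(** * Perron-Frobenius upper bound for nonnegative matrices, with its equality case *)

Lemma normc_sum_le (R : realType) (I : finType) (F : I -> R[i]%C) :
  Normc.normc (\sum_i F i) <= \sum_i Normc.normc (F i).
Proof.
elim/big_ind2: _ => [|x1 x2 y1 y2 le1 le2|//]; first by rewrite Normc.normc0.
exact: le_trans (le_normcD _ _) (lerD le1 le2).
Qed.

Lemma normc_ge0 (R : realType) (z : R[i]%C) : 0 <= Normc.normc z.
Proof. by case: z => a b; apply: sqrtr_ge0. Qed.

Lemma normc_real (R : realType) (x : R) :
  Normc.normc (real_complex R x) = `|x|.
Proof. by rewrite /= expr0n addr0 sqrtr_sqr. Qed.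

(** Taking moduli entrywise in an eigenvector turns the eigenvalue equation into an inequality, by
    the triangle inequality. The vector is a left one because [eigenvalue] refers to row vectors. *)
Lemma abs_left_eigenvector (R : realType) (n : nat) (B : 'M[R]_n) (z : R[i]%C) :
  (forall i j, 0 <= B i j) -> eigenvalue (map_mx (real_complex R) B) z ->
  exists w : 'I_n -> R, [/\ forall i, 0 <= w i, exists i, 0 < w i &
    forall j, Normc.normc z * w j <= \sum_i w i * B i j].
Proof.
move=> B0 /eigenvalueP[v vB vn0].
exists (fun i => Normc.normc (v 0 i)); split=> [i||j]; first exact: normc_ge0.
  have [i vi|v0] := pickP (fun i => v 0 i != 0); last first.
    by case/eqP: vn0; apply/rowP => i; rewrite mxE; apply/eqP/negbFE/v0.
  exists i; rewrite lt_neqAle normc_ge0 andbT eq_sym.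
  by apply: contra vi => /eqP/Normc.eq0_normc ->.
move: vB => /rowP/(_ j); rewrite !mxE => vB.
rewrite -Normc.normcM -vB; apply: le_trans (normc_sum_le _) _.
apply: ler_sum => i _; rewrite mxE Normc.normcM normc_real ger0_norm //.
Qed.

Lemma spectral_radius_attained (R : realType) (n : nat) (B : 'M[R]_n) :
  (0 < n)%N -> (forall i j, 0 <= B i j) ->
  exists w : 'I_n -> R, [/\ forall i, 0 <= w i, exists i, 0 < w i &
    forall j, spectral_radius B * w j <= \sum_i w i * B i j].
Proof.
move=> n0 B0; have [[z eigz ->] _] := spectral_radius_max B n0.
exact: abs_left_eigenvector eigz.
Qed.

(* Pairing a nonnegative left subinvariant vector w with a positive right
   superinvariant vector x. *)
Lemma spectral_radius_le (R : realType) (n : nat) (B : 'M[R]_n)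
    (x : 'I_n -> R) (l : R) :
  (0 < n)%N -> (forall i j, 0 <= B i j) -> (forall i, 0 < x i) ->
  (forall i, \sum_j B i j * x j <= l * x i) ->
  spectral_radius B <= l.
Proof.
move=> n0 B0 x0 Bx; have [w [w0 [i0 wi0] wB]] := spectral_radius_attained n0 B0.
have wx0 : 0 < \sum_i w i * x i.
  rewrite (bigD1 i0) //= ltr_pwDl ?mulr_gt0 // sumr_ge0 // => i _.
  by rewrite mulr_ge0 // ltW.
rewrite -(ler_pM2r wx0) mulr_sumr mulr_sumr.
apply: (@le_trans _ _ (\sum_j (\sum_i w i * B i j) * x j)).
  by apply: ler_sum => j _; rewrite mulrA ler_wpM2r // ltW.
under eq_bigr do rewrite mulr_suml.
rewrite exchange_big; apply: ler_sum => i _ /=.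
under eq_bigr do rewrite -mulrA.
by rewrite -mulr_sumr mulrCA ler_wpM2l.
Qed.

Lemma eq_sum_le (R : realType) (I : finType) (F G : I -> R) :
  (forall i, F i <= G i) -> \sum_i G i <= \sum_i F i -> forall i, F i = G i.
Proof.
move=> FG GF i; apply/eqP; rewrite eq_le FG /=.
have := GF; rewrite (bigD1 i) // [X in _ <= X](bigD1 i) //=.
have : \sum_(j | j != i) F j <= \sum_(j | j != i) G j.
  by apply: ler_sum.
lra.
Qed.

(** Equality in the pairing of [spectral_radius_le] forces equality in each column term, so
    positivity of [w] propagates along the positive entries of [B]. By connectivity [w] is positive
    everywhere, and the equality of the weighted sums then descends to every single row. *)
Lemma spectral_radius_eq (R : realType) (n : nat) (B : 'M[R]_n)
    (x : 'I_n -> R) (l : R) :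
  (0 < n)%N -> (forall i j, 0 <= B i j) -> (forall i, 0 < x i) ->
  (forall i j, connect (fun i j => 0 < B i j) i j) ->
  (forall i, \sum_j B i j * x j <= l * x i) ->
  spectral_radius B = l -> forall i, \sum_j B i j * x j = l * x i.
Proof.
move=> n0 B0 x0 Bc Bx srB.
have [w [w0 [i0 wi0] wB]] := spectral_radius_attained n0 B0.
rewrite srB in wB.
have le_sum : \sum_j (\sum_i w i * B i j) * x j <= \sum_i w i * (l * x i).
  under eq_bigr do rewrite mulr_suml.
  rewrite exchange_big; apply: ler_sum => i _ /=.
  under eq_bigr do rewrite -mulrA.
  by rewrite -mulr_sumr ler_wpM2l.
have wBE j : l * w j * x j = (\sum_i w i * B i j) * x j.
  move: j; apply: eq_sum_le => [j|]; first by rewrite ler_wpM2r // ltW.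
  by apply: le_trans le_sum _; apply: ler_sum => j _; rewrite mulrCA mulrA.
have wstep i j : 0 < B i j -> 0 < w i -> 0 < w j.
  move=> Bij wi; rewrite lt_neqAle w0 andbT; apply/eqP => wj0.
  have := wBE j; rewrite -wj0 mulr0 mul0r => /esym/eqP.
  rewrite mulf_eq0 (gt_eqF (x0 j)) orbF => /eqP wBj.
  have : 0 < \sum_k w k * B k j.
    rewrite (bigD1 i) //= ltr_pwDl ?mulr_gt0 // sumr_ge0 // => k _.
    exact: mulr_ge0.
  by rewrite wBj ltxx.
have wpos j : 0 < w j.
  have /connectP[p i0p ->] := Bc i0 j.
  elim: p i0 wi0 i0p => //= a p IH i0 wi0 /andP[Ba]; apply: IH.
  exact: wstep Ba wi0.
move=> i; apply: (mulfI (lt0r_neq0 (wpos i))); move: i.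
apply: eq_sum_le => [i|]; first by rewrite ler_wpM2l.
under eq_bigr do rewrite mulrCA mulrA.
under [X in _ <= X]eq_bigr do rewrite mulr_sumr.
rewrite [X in _ <= X]exchange_big; apply: ler_sum => j _ /=.
rewrite wBE mulr_suml; apply: ler_sum => i _; rewrite mulrA //.
Qed.

(** * Positive left supersolutions and the Perron-Frobenius lower bound *)

(** If the smallest entry [v m] were negative, bounding every [v i] below by [v m] and then dividing
    by [v m] would make the column sum at [m] at least [T]. *)
Lemma superinvariant_ge0 (R : realType) (n : nat) (B : 'M[R]_n)
    (T : R) (v : 'I_n -> R) :
  (forall i j, 0 <= B i j) -> (forall j, \sum_i B i j < T) ->
  (forall j, \sum_i v i * B i j <= T * v j) -> forall j, 0 <= v j.
Proof.
move=> B0 BT vB j.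
case: (arg_minP v (i0 := j) (P := predT) isT) => m _ vm.
apply: le_trans (vm j isT); rewrite leNgt; apply/negP => vm0.
have : v m * \sum_i B i m <= T * v m.
  apply: le_trans (vB m); rewrite mulr_sumr; apply: ler_sum => i _.
  by rewrite ler_wpM2r // vm.
by rewrite mulrC ler_nM2r // leNgt BT.
Qed.

Lemma seq_max (R : realType) (s : seq R) :
  s != [::] -> exists2 z, z \in s & forall w, w \in s -> w <= z.
Proof.
elim: s => // a [_ _|b s /(_ isT)[z zs zmax] _].
  by exists a; rewrite ?mem_head // => w; rewrite inE => /eqP->.
have [az|za] := leP a z.
  by exists z => [|w]; rewrite inE ?zs ?orbT // => /predU1P[->|/zmax].
exists a => [|w]; rewrite inE ?eqxx // => /predU1P[-> //|/zmax wz].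
exact: le_trans wz (ltW za).
Qed.

Lemma poly_ivt_gt0 (R : realType) (p : {poly R}) (a b : R) :
  (forall x, a <= x -> x <= b -> ~~ root p x) -> a <= b ->
  0 < p.[b] -> 0 < p.[a].
Proof.
move=> nroot ab pb; rewrite ltNge; apply/negP => pa.
have [|x /andP[ax xb]] := @poly_ivt _ p a b ab; first by rewrite pa ltW.
by apply/negP; apply: nroot.
Qed.

(* At the largest root t1 of the product of the u_j, all u_j are nonnegative,
   hence positive, so that t1 must be at most r. *)
Lemma poly_family_pos (R : realType) (I : finType) (u : I -> {poly R})
    (r T : R) :
  (forall t, T <= t -> forall j, 0 < (u j).[t]) ->
  (forall t, r < t -> (forall j, 0 <= (u j).[t]) -> forall j, 0 < (u j).[t]) ->
  forall t, r < t -> forall j, 0 < (u j).[t].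
Proof.
move=> uT ur; set p := \prod_j u j.
have root_p j x : root (u j) x -> root p x.
  by rewrite /p (bigD1 j) //= rootM => ->.
have pn0 : p != 0.
  apply/negP => /eqP p0; have : p.[T] != 0; last by rewrite p0 horner0 eqxx.
  by rewrite horner_prod; apply/prodf_neq0 => j _; rewrite gt_eqF // uT.
have root_lt x : root p x -> x < T.
  rewrite ltNge; apply: contraL => Tx; rewrite /root horner_prod.
  by apply/prodf_neq0 => j _; rewrite gt_eqF // uT.
have rootsE x : root p x = (x \in rootsR p).
  by rewrite -(roots_on_rootsR pn0) in_itv.
have no_root t : (forall x, t <= x -> ~~ root p x) -> forall j, 0 < (u j).[t].
  move=> nroot j; have [Tt|tT] := leP T t; first exact: uT.
  apply: (@poly_ivt_gt0 _ _ _ T) (ltW tT) (uT _ (lexx _) _) => x tx _.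
  by apply: contra (nroot _ tx); apply: root_p.
move=> t rt j.
have [r0|/seq_max[t1 t1p t1max]] := eqVneq (rootsR p) [::].
  by apply: no_root => x _; rewrite rootsE r0.
have [t1t|tt1] := ltP t1 t.
  apply: no_root => x tx; rewrite rootsE; apply/negP => /t1max xt1.
  by have := lt_le_trans t1t (le_trans tx xt1); rewrite ltxx.
have rt1 := lt_le_trans rt tt1.
have t1root : root p t1 by rewrite rootsE.
have u1 i : 0 <= (u i).[t1].
  rewrite leNgt; apply/negP => ut1.
  have [|x /andP[t1x _] ux] := @poly_ivt _ (u i) t1 T (ltW (root_lt _ t1root)).
    by rewrite !ltW // uT.
  have := t1max x; rewrite -rootsE (root_p i) // => /(_ isT) xt1.
  have xE : x = t1 by apply/eqP; rewrite eq_le xt1.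
  by move: ut1; rewrite -xE (rootP ux) ltxx.
have : p.[t1] != 0.
  by rewrite horner_prod; apply/prodf_neq0 => i _; rewrite gt_eqF // ur.
by rewrite (rootP t1root) eqxx.
Qed.

Lemma char_poly_horner_neq0 (R : realType) (n : nat) (B : 'M[R]_n) (t : R) :
  (0 < n)%N -> spectral_radius B < t -> (char_poly B).[t] != 0.
Proof.
move=> n0 rt; apply/negP => /eqP chi0; have [_ srmax] := spectral_radius_max B n0.
have := srmax (real_complex R t).
rewrite eigenvalue_root_char -map_char_poly fmorph_root => /(_ (introT rootP chi0)).
rewrite -[complex.Re _]/(Normc.normc _) normc_real => tr.
by have := lt_le_trans rt (le_trans (ler_norm t) tr); rewrite ltxx.
Qed.

(* u(t) = chi(t) * 1 * adj(t - B) is polynomial in t and satisfies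
   u(t) (t - B) = chi(t)^2 * 1; it is positive for large t, and it cannot
   acquire a zero entry as t decreases to the spectral radius. *)
Lemma exists_left_supersolution (R : realType) (n : nat) (B : 'M[R]_n) (t : R) :
  (0 < n)%N -> (forall i j, 0 <= B i j) -> spectral_radius B < t ->
  exists u : 'I_n -> R,
    (forall j, 0 < u j) /\ forall j, \sum_i u i * B i j < t * u j.
Proof.
move=> n0 B0 rt; set chi := char_poly B.
pose U : 'rV[{poly R}]_n := chi *: (const_mx 1 *m \adj (char_poly_mx B)).
have UE : U *m char_poly_mx B = const_mx (chi ^+ 2).
  rewrite -scalemxAl -mulmxA mul_adj_mx mul_mx_scalar scalerA.
  by apply/rowP => j; rewrite !mxE mulr1 expr2.
clearbody U.
have uE s j : s * (U 0 j).[s] - \sum_i (U 0 i).[s] * B i j = chi.[s] ^+ 2.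
  move/rowP/(_ j)/(congr1 (horner^~ s)): UE.
  rewrite [in RHS]mxE horner_exp => <-; rewrite [in RHS]mxE horner_sum.
  under [RHS]eq_bigr => i _ do
    rewrite hornerM !mxE hornerD hornerN hornerC hornerMn hornerX mulrBr.
  rewrite big_split /= sumrN; congr (_ - _).
  rewrite (bigD1 j) //= eqxx mulr1n big1 ?addr0 1?mulrC // => i /negbTE ->.
  by rewrite mulr0n mulr0.
have r0 : 0 <= spectral_radius B.
  by have [[z _ ->] _] := spectral_radius_max B n0; apply: normc_ge0.
(* By [uE], [s] times an entry of [u(s)] is a nonnegative sum plus the square of [chi.[s]], which is
   nonzero above the spectral radius. *)
have upos s : spectral_radius B < s -> (forall j, 0 <= (U 0 j).[s]) ->
    forall j, 0 < (U 0 j).[s].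
  move=> rs u0 j; have s0 := le_lt_trans r0 rs.
  rewrite -(pmulr_rgt0 _ s0); move/eqP: (uE s j); rewrite subr_eq => /eqP ->.
  rewrite ltr_pwDl ?exprn_even_gt0 ?char_poly_horner_neq0 ?orbT //.
  by rewrite sumr_ge0 // => i _; rewrite mulr_ge0.
exists (fun j => (U 0 j).[t]); split=> [|j]; last first.
  by rewrite -subr_gt0 uE exprn_even_gt0 ?char_poly_horner_neq0 ?orbT.
(* This [T] exceeds both the spectral radius and every column sum, so beyond it [superinvariant_ge0]
   gives nonnegativity and [upos] improves it to positivity. *)
pose T := 1 + t + \sum_i \sum_j B i j.
have S0 : 0 <= \sum_i \sum_j B i j by do 2![apply: sumr_ge0 => ? _].
have BT j : \sum_i B i j <= \sum_i \sum_j B i j.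
  by apply: ler_sum => i _; rewrite (bigD1 j) //= lerDl sumr_ge0.
move: (t) (rt); apply: (@poly_family_pos _ _ (fun j => U 0 j) _ T) => // s Ts j.
have t0 := le_lt_trans r0 rt.
apply: upos j; first by rewrite /T in Ts; lra.
apply: (superinvariant_ge0 (T := s) B0) => j.
  by have := BT j; rewrite /T in Ts; lra.
by have := sqr_ge0 chi.[s]; rewrite -(uE s j); lra.
Qed.

(** If the spectral radius were below [l], there would be a positive [u] with [u B < l u].
    Evaluating [u B y] from the left makes it strictly smaller than [l u y], while evaluating it
    from the right makes it at least [l u y]. *)
Lemma spectral_radius_ge (R : realType) (n : nat) (B : 'M[R]_n)
    (y : 'I_n -> R) (l : R) :
  (0 < n)%N -> (forall i j, 0 <= B i j) ->
  (forall i, 0 <= y i) -> (exists i, 0 < y i) ->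
  (forall i, l * y i <= \sum_j B i j * y j) ->
  l <= spectral_radius B.
Proof.
move=> n0 B0 y0 [i0 yi0] By; rewrite leNgt; apply/negP => rl.
have [u [u0 uB]] := exists_left_supersolution n0 B0 rl.
have : \sum_j (\sum_i u i * B i j) * y j < \sum_j (l * u j) * y j.
  rewrite (bigD1 i0) //= [X in _ < X](bigD1 i0) //= ltr_leD ?ltr_pM2r //.
  by apply: ler_sum => j _; rewrite ler_wpM2r // ltW.
apply/negP; rewrite -leNgt.
under [X in _ <= X]eq_bigr do rewrite mulr_suml.
rewrite [X in _ <= X]exchange_big; apply: ler_sum => i _ /=.
under [X in _ <= X]eq_bigr do rewrite -mulrA.
by rewrite -mulr_sumr -mulrA mulrCA ler_wpM2l // ltW.
Qed.

Lemma exists_pos_lower_bound (R : realType) (I : finType) (F : I -> R) :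
  (forall i, 0 < F i) -> exists2 e, 0 < e & forall i, e <= F i.
Proof.
move=> F0; have [i0 _|I0] := pickP (@predT I); last first.
  by exists 1 => [|i] //; have := I0 i.
case: (arg_minP F (i0 := i0) (P := predT) isT) => m _ mF.
by exists (F m) => // i; apply: mF.
Qed.

(* Otherwise (1 + B) y would be strictly superinvariant, for a larger l. *)
Lemma spectral_radius_eq_super (R : realType) (n : nat) (B : 'M[R]_n)
    (y : 'I_n -> R) (l : R) :
  (0 < n)%N -> (forall i j, 0 <= B i j) -> (forall i j, i != j -> 0 < B i j) ->
  (forall i, 0 < y i) -> (forall i, l * y i <= \sum_j B i j * y j) ->
  spectral_radius B = l -> forall i, \sum_j B i j * y j = l * y i.
Proof.
move=> n0 B0 Bpos y0 By srB i0; apply/eqP; rewrite eq_le By andbT leNgt.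
apply/negP => By0.
pose w i := \sum_j B i j * y j - l * y i.
have w0 i : 0 <= w i by rewrite subr_ge0.
pose x i := y i + \sum_j B i j * y j.
have x0 i : 0 < x i.
  by rewrite ltr_pwDl // sumr_ge0 // => j _; rewrite mulr_ge0 // ltW.
have wx i : \sum_j B i j * x j - l * x i = w i + \sum_j B i j * w j.
  rewrite /w /x; under eq_bigr do rewrite mulrDr.
  under [X in _ = _ + X]eq_bigr do rewrite mulrBr mulrCA.
  by rewrite big_split sumrB /= -mulr_sumr; ring.
(* The defect [w] is nonzero at [i0]; the positive off-diagonal entries of [B] spread it to all
   other indices, and the summand [w i] covers [i0] itself. *)
have z0 i : 0 < w i + \sum_j B i j * w j.
  have wi0 : 0 < w i0 by rewrite subr_gt0.
  have [->|ii0] := eqVneq i i0.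
    by rewrite ltr_pwDl // sumr_ge0 // => j _; rewrite mulr_ge0.
  rewrite ltr_wpDl // (bigD1 i0) //= ltr_pwDl ?mulr_gt0 ?Bpos //.
  by rewrite sumr_ge0 // => j _; rewrite mulr_ge0.
have [|e e0 eF] := @exists_pos_lower_bound _ _
  (fun i => (w i + \sum_j B i j * w j) / x i).
  by move=> i; rewrite divr_gt0.
have : l + e <= spectral_radius B.
  apply: (spectral_radius_ge n0 B0 (fun i => ltW (x0 i))); first by exists i0.
  move=> i; have := eF i; rewrite ler_pdivlMr // -wx mulrDl; lra.
by rewrite srB gerDl leNgt e0.
Qed.

(** * Comparison of two matrices through one positive test vector *)

(** In the equality case [B x = l x], and [N x] is squeezed between [B x] and [l x]; since [x] is
    positive, equal row sums against [x] force equal entries. Conversely a positive eigenvector of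
    [N] for [l] bounds the spectral radius from both sides. *)
Lemma spectral_radius_comparison_le (R : realType) (n : nat) (B N : 'M[R]_n)
    (x : 'I_n -> R) (l : R) :
  (0 < n)%N -> (forall i j, 0 <= B i j) -> (forall i j, B i j <= N i j) ->
  (forall i, 0 < x i) -> (forall i j, connect (fun i j => 0 < B i j) i j) ->
  (forall i, \sum_j N i j * x j <= l * x i) ->
  spectral_radius B <= l /\
  (spectral_radius B = l <->
   B = N /\ forall i, \sum_j N i j * x j = l * x i).
Proof.
move=> n0 B0 BN x0 Bc Nx.
have BNx i : \sum_j B i j * x j <= \sum_j N i j * x j.
  by apply: ler_sum => j _; rewrite ler_wpM2r // ltW.
have Bx i : \sum_j B i j * x j <= l * x i by apply: le_trans (BNx i) (Nx i).
have le_l := spectral_radius_le n0 B0 x0 Bx.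
split=> //; split=> [srB|[-> NE]]; last first.
  have N0 i j : 0 <= N i j by apply: le_trans (B0 i j) (BN i j).
  apply/eqP; rewrite eq_le (spectral_radius_le n0 N0 x0 Nx) /=.
  apply: (spectral_radius_ge n0 N0 (fun i => ltW (x0 i))) => [|i].
    by exists (Ordinal n0).
  by rewrite NE.
have BxE := spectral_radius_eq n0 B0 x0 Bc Bx srB.
have NE i : \sum_j N i j * x j = l * x i.
  by apply/eqP; rewrite eq_le Nx -BxE BNx.
split=> //; apply/matrixP => i j; apply: (mulIf (lt0r_neq0 (x0 j))); move: j.
by apply: eq_sum_le => [j|]; [rewrite ler_wpM2r // ltW | rewrite NE BxE].
Qed.

(** The mirror image of the previous comparison, with off-diagonal positivity of [B] in place of
    connectivity. *)
Lemma spectral_radius_comparison_ge (R : realType) (n : nat) (B N : 'M[R]_n)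
    (x : 'I_n -> R) (l : R) :
  (0 < n)%N -> (forall i j, 0 <= N i j) -> (forall i j, N i j <= B i j) ->
  (forall i, 0 < x i) -> (forall i j, i != j -> 0 < B i j) ->
  (forall i, l * x i <= \sum_j N i j * x j) ->
  l <= spectral_radius B /\
  (spectral_radius B = l <->
   B = N /\ forall i, \sum_j N i j * x j = l * x i).
Proof.
move=> n0 N0 NB x0 Bpos Nx.
have B0 i j : 0 <= B i j by apply: le_trans (N0 i j) (NB i j).
have NBx i : \sum_j N i j * x j <= \sum_j B i j * x j.
  by apply: ler_sum => j _; rewrite ler_wpM2r // ltW.
have Bx i : l * x i <= \sum_j B i j * x j by apply: le_trans (Nx i) (NBx i).
have ge_l : l <= spectral_radius B.
  apply: (spectral_radius_ge n0 B0 (fun i => ltW (x0 i))) => //.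
  by exists (Ordinal n0).
split=> //; split=> [srB|[BN NE]]; last first.
  apply/eqP; rewrite eq_le ge_l andbT.
  by apply: (spectral_radius_le n0 B0 x0) => i; rewrite BN NE.
have BxE := spectral_radius_eq_super n0 B0 Bpos x0 Bx srB.
have NE i : \sum_j N i j * x j = l * x i.
  by apply/eqP; rewrite eq_le Nx -BxE NBx.
split=> //; apply/esym/matrixP => i j.
apply: (mulIf (lt0r_neq0 (x0 j))); move: j.
by apply: eq_sum_le => [j|]; [rewrite ler_wpM2r // ltW | rewrite NE BxE].
Qed.

(** * From a matrix to its signless Laplacian analogue *)

(** Applied to the adjacency and distance matrices this yields the signless Laplacian and the
    distance signless Laplacian, so both are treated by one computation. *)
Definition add_row_sums (R : realType) (n : nat) (M : 'M[R]_n) : 'M[R]_n :=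
  diag_mx (\row_i \sum_j M i j) + M.

Lemma add_row_sums_le (R : realType) (n : nat) (M N : 'M[R]_n) :
  (forall i j, M i j <= N i j) ->
  forall i j, add_row_sums M i j <= add_row_sums N i j.
Proof.
move=> MN i j; rewrite !mxE lerD //; case: (i == j) => //=.
by rewrite !mulr1n ler_sum.
Qed.

Lemma add_row_sums_offdiag (R : realType) (n : nat) (M : 'M[R]_n) i j :
  i != j -> add_row_sums M i j = M i j.
Proof. by move=> /negbTE ij; rewrite !mxE ij mulr0n add0r. Qed.

Lemma add_row_sums_ge (R : realType) (n : nat) (M : 'M[R]_n) :
  (forall i j, 0 <= M i j) -> forall i j, M i j <= add_row_sums M i j.
Proof.
by move=> M0 i j; rewrite !mxE lerDr mulrn_wge0 // sumr_ge0.
Qed.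

Lemma add_row_sums_inj (R : realType) (n : nat) (M N : 'M[R]_n) :
  (forall i, M i i = 0) -> (forall i, N i i = 0) ->
  add_row_sums M = add_row_sums N <-> M = N.
Proof.
move=> M0 N0; split=> [MN|-> //]; apply/matrixP => i j.
have [<-|ij] := eqVneq i j; first by rewrite M0 N0.
by rewrite -(add_row_sums_offdiag M ij) MN add_row_sums_offdiag.
Qed.

Lemma add_row_sums_mul (R : realType) (n : nat) (M : 'M[R]_n) (x : 'I_n -> R) i :
  \sum_j add_row_sums M i j * x j = (\sum_j M i j) * x i + \sum_j M i j * x j.
Proof.
under eq_bigr => j _ do rewrite mxE [diag_mx _ _ _]mxE [(\row_i _) _ _]mxE mulrDl.
rewrite big_split; congr (_ + _); rewrite (bigD1 i) //= eqxx mulr1n.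
rewrite [X in _ + X]big1 ?addr0 //.
by move=> j ji; rewrite eq_sym (negbTE ji) mulr0n mul0r.
Qed.

(** * Matrices of the extremal digraphs and their test vector *)

Section CutRel.
Variables (n : nat) (P Q : {set 'I_n}).
Hypothesis PQ : [disjoint P & Q].

(* The arcs of K(n, k, p), with Q in the role of the set R of the paper. *)
Definition cut_rel : rel 'I_n :=
  fun u v => (u != v) && ~~ ((u \in Q) && (v \in P)).

(* The adjacency matrix (s = -1) and the distance matrix (s = 1) of cut_rel. *)
Definition cut_mx (R : realType) (s : R) : 'M[R]_n :=
  \matrix_(u, v) ((u != v)%:R + s * ((u \in Q) && (v \in P))%:R).

Lemma cut_disjoint u v : (u \in Q) && (v \in P) -> u != v.
Proof.
case/andP=> uQ vP; apply: contraTneq uQ => ->.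
by rewrite (disjointFr PQ vP).
Qed.

Lemma cut_mx_diag (R : realType) (s : R) u : cut_mx s u u = 0.
Proof.
rewrite mxE eqxx add0r; case: (boolP (_ && _)) => [/cut_disjoint|].
  by rewrite eqxx.
by rewrite mulr0.
Qed.

Lemma cut_mxN1 (R : realType) u v : cut_mx (-1 : R) u v = (cut_rel u v)%:R.
Proof.
rewrite mxE /cut_rel; case: (boolP (_ && _)) => [/cut_disjoint ->|_] /=.
  by rewrite mulr1 subrr.
by rewrite mulr0 addr0 andbT.
Qed.

Lemma cut_mx_mul (R : realType) (s : R) (y : 'I_n -> R) u :
  \sum_v cut_mx s u v * y v =
  \sum_v y v - y u + s * (u \in Q)%:R * \sum_(v in P) y v.
Proof.
under eq_bigr => v _ do rewrite mxE mulrDl.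
rewrite big_split /=; congr (_ + _).
  rewrite [in RHS](bigD1 u) //= addrAC subrr add0r (bigD1 u) //= eqxx mul0r add0r.
  by apply: eq_bigr => v vu; rewrite eq_sym vu mul1r.
rewrite mulr_sumr [RHS]big_mkcond; apply: eq_bigr => v _ /=.
by case: (u \in Q); case: (v \in P); rewrite ?mulr0 ?mul0r.
Qed.

Section TestVector.
Variables (R : realType) (mu : R).
Let p : R := #|P|%:R.
Let r : R := #|Q|%:R.

(* For the weights a off Q and c on Q, the eigenvalue equation of cut_mx off Q
   reads mu * a = (n - r) * a + r * c with mu = l + 1. *)
Definition test_vector (u : 'I_n) : R :=
  if u \in Q then mu - (n%:R - r) else r.

Lemma sum_test_vector : \sum_u test_vector u = r * mu.
Proof.
rewrite (bigID (mem Q)) /= /test_vector.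
under eq_bigr => u uQ do rewrite uQ.
under [X in _ + X]eq_bigr => u uQ do rewrite (negbTE uQ).
have nE : n%:R = r + #|[predC Q]|%:R.
  by rewrite -natrD cardC card_ord.
by rewrite !sumr_const nE -mulr_natl -[r *+ _]mulr_natl -/r; ring.
Qed.

Lemma sum_test_vectorP : \sum_(u in P) test_vector u = p * r.
Proof.
rewrite /test_vector; under eq_bigr => u uP do rewrite (disjointFr PQ uP).
by rewrite sumr_const -mulr_natl.
Qed.

(** Off [Q] the weights were chosen to make the eigenvalue equation exact. On [Q] all rows have the
    same defect, a quadratic in [mu] whose sign decides the comparison. *)
Lemma cut_mx_test (s : R) u :
  \sum_v cut_mx s u v * test_vector v =
  (mu - 1) * test_vector u - (u \in Q)%:R * (mu * (mu - n%:R) - s * p * r).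
Proof.
rewrite cut_mx_mul sum_test_vector sum_test_vectorP /test_vector.
by case: (u \in Q); rewrite /=; ring.
Qed.

(** Off [Q] all row sums equal [n - 1], which shifts the eigenvalue from [mu - 1] to [mu + n - 2].
    On [Q] they differ from this by [s * p], which adds [- s * p * (mu - n + r)] to the defect. *)
Lemma add_row_sums_cut_mx_test (s : R) u :
  \sum_v add_row_sums (cut_mx s) u v * test_vector v =
  (mu + n%:R - 2) * test_vector u
  - (u \in Q)%:R * (mu * (mu - n%:R) - s * p * (mu - n%:R + 2 * r)).
Proof.
rewrite add_row_sums_mul cut_mx_test.
have -> : \sum_v cut_mx s u v = n%:R - 1 + s * (u \in Q)%:R * p.
  under eq_bigr do rewrite -[cut_mx s u _]mulr1.
  by rewrite cut_mx_mul !sumr_const card_ord.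
rewrite /test_vector; case: (u \in Q); rewrite /=; ring.
Qed.

Lemma test_vector_gt0 : (0 < #|Q|)%N -> n%:R - r < mu ->
  forall u, 0 < test_vector u.
Proof.
by move=> r0 rmu u; rewrite /test_vector; case: ifP; rewrite ?subr_gt0 ?ltr0n.
Qed.

End TestVector.

End CutRel.

(** * Cut pairs and isomorphism with K(n, k, p) *)

(** How [Q] arose from reachability is forgotten, so that the classes of an isomorphic copy of K(n,
    k, p) form a cut pair as well. *)
Record cut_pair (n k : nat) (G : digraph 'I_n) (P Q : {set 'I_n}) : Prop :=
  CutPair {
    cut_pair_disjoint : [disjoint P & Q];
    cut_pairP_gt0 : (0 < #|P|)%N;
    cut_pairQ_gt0 : (0 < #|Q|)%N;
    cut_pair_card : (#|P| + #|Q| + k)%N = n;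
    cut_pair_sub : subrel G (cut_rel P Q)
  }.

Lemma Omega_cut_pair (n k : nat) (G : digraph 'I_n) :
  (1 <= k)%N -> (k <= n - 2)%N -> Omega k G -> exists P Q, cut_pair k G P Q.
Proof.
move=> k1 kn /andP[sG /eqP kG].
(* A complete digraph has connectivity [n - 1], outside the allowed range of [k]. *)
have ncG : ~~ complete_digraph G.
  apply/negP => cG; move: kG; rewrite /vertex_connectivity cG card_ord; lia.
have [[S nsS cardS] _] := vertex_connectivityP ncG.
case/forallPn: nsS => u /forallPn[v nuv].
pose Q := [set val w | w in connect (induced G (~: S)) u].
pose P := ~: S :\: Q.
have QS w : w \in Q -> w \in ~: S by case/imsetP => y _ ->; apply: valP.
have uQ : val u \in Q by apply: imset_f; apply: connect0.
have vP : val v \in P.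
  rewrite inE (valP v) andbT; apply: contra nuv => /imsetP[w uw vw].
  by rewrite (val_inj vw).
have PQ : [disjoint P & Q].
  by rewrite disjoints_subset; apply/subsetP => w; rewrite !inE => /andP[].
exists P, Q; split=> //; try by apply/card_gt0P; eexists; eassumption.
  have QsS : Q \subset ~: S by apply/subsetP.
  have := cardsD (~: S) Q; rewrite -/P (setIidPr QsS).
  have := subset_leq_card QsS; have := cardsC S; rewrite card_ord cardS kG.
  lia.
move=> a b Gab; apply/andP; split.
  by apply: contraTneq Gab => ->; rewrite arc_irrefl.
apply/negP => /andP[/imsetP[a' ua' aE] bP].
(* An arc from [Q] to [b], which avoids the cut, would make [b] reachable too. *)
move: (bP); rewrite inE => /andP[/negP bQ bS]; apply: bQ.
apply/imsetP; exists (Sub b bS) => //; apply: connect_trans ua' (connect1 _).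
by rewrite /= /induced_rel /= -aE.
Qed.

Lemma card_K_in_P (n k p : nat) : #|[set x : K_vertex n k p | K_in_P x]| = p.
Proof.
rewrite cardsE -sum1_card big_mkcond /= big_sumType big_sumType /=.
by rewrite sum1_card card_ord !big1_eq !addn0.
Qed.

Lemma card_K_in_R (n k p : nat) :
  #|[set x : K_vertex n k p | K_in_R x]| = (n - p - k)%N.
Proof.
rewrite cardsE -sum1_card big_mkcond /= big_sumType /=.
by rewrite sum1_card card_ord !big1_eq add0n.
Qed.

(** An isomorphism pulls the two outer classes of K(n, k, p) back to [P] and [Q]. Conversely,
    enumerating [P], the remaining vertices and [Q] gives a bijection that respects the classes, and
    these alone determine the arcs. *)
Lemma iso_K_cut (n k p : nat) (G : digraph 'I_n) : (p + k <= n)%N ->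
  digraph_iso G (K n k p) <->
  exists P Q : {set 'I_n}, [/\ [disjoint P & Q], #|P| = p, #|Q| = (n - p - k)%N &
                  G =2 cut_rel P Q].
Proof.
move=> pkn; split=> [[f fbij fG]|[P [Q [PQ cardP cardQ GE]]]].
  have card_pre (A : {set K_vertex n k p}) : #|f @^-1: A| = #|A|.
    by apply: on_card_preimset; apply: onW_bij.
  exists (f @^-1: [set x | K_in_P x]), (f @^-1: [set x | K_in_R x]); split.
  - rewrite disjoints_subset; apply/subsetP => u; rewrite !inE.
    by case: (f u) => [[]|].
  - by rewrite card_pre card_K_in_P.
  - by rewrite card_pre card_K_in_R.
  - by move=> u v; rewrite -fG /cut_rel !inE -(inj_eq (bij_inj fbij)).
pose S := ~: (P :|: Q).
have cardS : #|S| = k.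
  have := cardsC (P :|: Q); rewrite -/S cardsU (disjoint_setI0 PQ) cards0.
  rewrite card_ord cardP cardQ; lia.
pose g (x : K_vertex n k p) : 'I_n :=
  match x with
  | inl (inl i) => enum_val (cast_ord (esym cardP) i)
  | inl (inr i) => enum_val (cast_ord (esym cardS) i)
  | inr i => enum_val (cast_ord (esym cardQ) i)
  end.
have gP x : (g x \in P) = K_in_P x.
  case: x => [[i|i]|i] /=; first exact: enum_valP.
    have := enum_valP (cast_ord (esym cardS) i).
    by rewrite !inE negb_or => /andP[/negbTE].
  by rewrite (disjointFl PQ) // enum_valP.
have gQ x : (g x \in Q) = K_in_R x.
  case: x => [[i|i]|i] /=; last exact: enum_valP.
    by rewrite (disjointFr PQ) // enum_valP.
  have := enum_valP (cast_ord (esym cardS) i).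
  by rewrite !inE negb_or => /andP[_ /negbTE].
have g_inj : injective g.
  move=> x y gxy; have := gP x; have := gQ x; rewrite gxy gP gQ.
  case: x y gxy => [[i|i]|i] [[j|j]|j] //= /enum_val_inj/cast_ord_inj -> //.
have [|f gK fK] := inj_card_bij g_inj.
  by rewrite !card_sum !card_ord; lia.
exists f; first by exists g.
by move=> u v; rewrite GE -{2}[u]fK -{2}[v]fK /= /K_rel /cut_rel gP gQ
  (inj_eq g_inj).
Qed.

(** * The four bounds for a digraph with a given cut pair *)

(** Four times the quadratic at [t] is [(2 t - b)^2 - D], so a negative value puts [t] strictly
    between two real roots. The bound [t < m] later yields positivity of the test vector. *)
Lemma quadratic_root (R : realType) (b c D t : R) :
  D = b ^+ 2 - 4 * c -> t ^+ 2 - b * t + c < 0 ->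
  let m := (b + Num.sqrt D) / 2 in m ^+ 2 - b * m + c = 0 /\ t < m.
Proof.
move=> DE tc m; have tD : (2 * t - b) ^+ 2 < D by rewrite DE; lra.
have D0 : 0 <= D by apply: le_trans (ltW tD); apply: sqr_ge0.
have mE : Num.sqrt D = 2 * m - b by rewrite /m; field.
split; first by have := sqr_sqrtr D0; rewrite mE DE; lra.
have : `|2 * t - b| < Num.sqrt D.
  by rewrite -sqrtr_sqr ltr_sqrt // (le_lt_trans _ tD) // sqr_ge0.
rewrite mE ltr_norml => /andP[_]; lra.
Qed.

Section Comparison.
Variables (R : realType) (n k : nat) (G : digraph 'I_n) (P Q : {set 'I_n}).
Hypotheses (sG : strongly_connected G) (k1 : (1 <= k)%N).
Hypothesis (cG : cut_pair k G P Q).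

Let PQ : [disjoint P & Q] := cut_pair_disjoint cG.

Let n_gt0 : (0 < n)%N.
Proof. by have := cut_pair_card cG; have := cut_pairP_gt0 cG; lia. Qed.

Lemma adjacency_le_cut u v : adjacency_mx R G u v <= cut_mx P Q (-1) u v.
Proof.
rewrite cut_mxN1 // mxE ler_nat.
by case: (boolP (G u v)) => // /(cut_pair_sub cG) ->.
Qed.

Lemma adjacency_eq_cut :
  adjacency_mx R G = cut_mx P Q (-1) <-> G =2 cut_rel P Q.
Proof.
split=> [/matrixP AE u v|GE]; last first.
  by apply/matrixP => u v; rewrite cut_mxN1 // mxE GE.
have := AE u v; rewrite cut_mxN1 // mxE => /eqP; rewrite eqr_nat.
by case: (G u v); case: (cut_rel _ _ _ _).
Qed.

Lemma adjacency_diag u : adjacency_mx R G u u = 0.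
Proof. by rewrite mxE arc_irrefl. Qed.

Lemma adjacency_ge0 u v : 0 <= adjacency_mx R G u v.
Proof. by rewrite mxE ler0n. Qed.

Lemma connect_support (M : 'M[R]_n) :
  (forall u v, adjacency_mx R G u v <= M u v) ->
  forall u v, connect (fun u v => 0 < M u v) u v.
Proof.
move=> AM u v; have /forallP/(_ u)/forallP/(_ v) := sG.
apply: connect_sub => a b Gab; apply: connect1; apply: lt_le_trans (AM a b).
by rewrite mxE Gab ltr01.
Qed.

Lemma signless_laplacianE :
  signless_laplacian_mx R G = add_row_sums (adjacency_mx R G).
Proof.
rewrite /signless_laplacian_mx /add_row_sums; congr (diag_mx _ + _).
apply/rowP => u; rewrite !mxE /outdegree cardsE.
rewrite -sum1_card natr_sum big_mkcond; apply: eq_bigr => v _ /=.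
by rewrite mxE -[v \in _]/(G u v); case: (G u v).
Qed.

Lemma distance_uu u : distance G u u = 0%N.
Proof.
have [_ /(_ [::] isT erefl)] := distanceP (connect0 G u).
by rewrite leqn0 => /eqP.
Qed.

Lemma distance_gt0 u v : u != v -> (0 < distance G u v)%N.
Proof.
move=> uv; have /forallP/(_ u)/forallP/(_ v)/distanceP[[p [_ pv <-]] _] := sG.
by case: p pv => //= uE; rewrite uE eqxx in uv.
Qed.

Lemma distance_le1 u v : u != v -> (distance G u v <= 1)%N = G u v.
Proof.
move=> uv; have /forallP/(_ u)/forallP/(_ v)/distanceP[[p [up pv dE]] min] := sG.
apply/idP/idP => [|Guv]; last by apply: (min [:: v]); rewrite //= Guv.
rewrite -dE; case: p up pv {dE} => [|a [|]] //= => [_ uE|]; first by rewrite uE eqxx in uv.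
by rewrite andbT => + <-.
Qed.

Lemma distance_diag u : distance_mx R G u u = 0.
Proof. by rewrite mxE distance_uu. Qed.

Lemma distance_pos u v : u != v -> 0 < distance_mx R G u v.
Proof. by move=> uv; rewrite mxE ltr0n distance_gt0. Qed.

Lemma cut_mx1 u v :
  cut_mx P Q (1 : R) u v = ((u != v) + (u \in Q) && (v \in P))%N%:R.
Proof. by rewrite mxE mul1r natrD. Qed.

Lemma cut_le_distance u v : cut_mx P Q 1 u v <= distance_mx R G u v.
Proof.
have [<-|uv] := eqVneq u v; first by rewrite cut_mx_diag // distance_diag.
rewrite cut_mx1 mxE ler_nat uv; case: (boolP (_ && _)) => [uQvP|_].
  rewrite ltnNge distance_le1 //; apply/negP => /(cut_pair_sub cG).
  by rewrite /cut_rel uQvP andbF.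
exact: distance_gt0.
Qed.

Lemma distance_eq_cut :
  distance_mx R G = cut_mx P Q 1 <-> G =2 cut_rel P Q.
Proof.
split=> [/matrixP DE u v|GE].
  have [<-|uv] := eqVneq u v; first by rewrite arc_irrefl /cut_rel eqxx.
  rewrite -distance_le1 // /cut_rel uv; have := DE u v.
  rewrite cut_mx1 mxE uv => /eqP; rewrite eqr_nat => /eqP ->.
  by case: (_ && _).
apply/matrixP => u v; apply/eqP; rewrite eq_le cut_le_distance andbT.
have [<-|uv] := eqVneq u v; first by rewrite cut_mx_diag // distance_diag.
rewrite cut_mx1 mxE ler_nat uv; case: (boolP (_ && _)) => [uQvP|uQvP].
  (* As [k] is positive, the cut contains some [w], and [u], [w], [v] is a walk of length 2. *)
  have [w wS] : exists w, w \in ~: (P :|: Q).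
    apply/card_gt0P; have := cardsC (P :|: Q).
    rewrite cardsU (disjoint_setI0 PQ) cards0 card_ord.
    have := cut_pair_card cG; lia.
  have [uQ vP] := andP uQvP; move: wS; rewrite !inE negb_or => /andP[wP wQ].
  have /forallP/(_ u)/forallP/(_ v)/distanceP[_ min] := sG.
  apply: (min [:: w; v]) => //=; rewrite !GE /cut_rel (negbTE wP) (negbTE wQ).
  rewrite andbF !andbT; apply/andP; split.
    by apply: contraNneq wQ => <-.
  by apply: contraNneq wP => ->.
by rewrite distance_le1 // GE /cut_rel uv.
Qed.

Let p : R := #|P|%:R.
Let r : R := #|Q|%:R.

Let p1 : 1 <= p. Proof. by rewrite ler1n (cut_pairP_gt0 cG). Qed.
Let r1 : 1 <= r. Proof. by rewrite ler1n (cut_pairQ_gt0 cG). Qed.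
Let kR1 : 1 <= k%:R :> R. Proof. by rewrite ler1n. Qed.
Let nE : n%:R = p + r + k%:R.
Proof. by rewrite -!natrD (cut_pair_card cG). Qed.

Let pr_ge0 : 0 <= (p - 1) * (r - 1).
Proof. by rewrite mulr_ge0 ?subr_ge0. Qed.
Let rk_gt0 : 0 < r * k%:R.
Proof. by apply: mulr_gt0; [move: r1 | move: kR1]; lra. Qed.

Let pE1 : p = 1 <-> #|P| = 1%N.
Proof. by rewrite /p; split=> [/eqP|->] //; rewrite pnatr_eq1 => /eqP. Qed.
Let rE1 : r = 1 <-> #|Q| = 1%N.
Proof. by rewrite /r; split=> [/eqP|->] //; rewrite pnatr_eq1 => /eqP. Qed.

(** Since [Q] is nonempty, a nonzero defect is visible in some row. *)
Lemma defect_eq0 (M : 'M[R]_n) (x : 'I_n -> R) (a e : R) :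
  (forall u, \sum_v M u v * x v = a * x u - (u \in Q)%:R * e) ->
  (forall u, \sum_v M u v * x v = a * x u) <-> e = 0.
Proof.
move=> ME; split=> [Ma|e0 u]; last by rewrite ME e0 mulr0 subr0.
have /card_gt0P[u uQ] := cut_pairQ_gt0 cG.
by have := Ma u; rewrite ME uQ mul1r; lra.
Qed.

Lemma defect_le (M : 'M[R]_n) (x : 'I_n -> R) (a e : R) :
  (forall u, \sum_v M u v * x v = a * x u - (u \in Q)%:R * e) ->
  0 <= e -> forall u, \sum_v M u v * x v <= a * x u.
Proof. by move=> ME e0 u; rewrite ME gerBl mulr_ge0. Qed.

Lemma defect_ge (M : 'M[R]_n) (x : 'I_n -> R) (a e : R) :
  (forall u, \sum_v M u v * x v = a * x u - (u \in Q)%:R * e) ->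
  e <= 0 -> forall u, a * x u <= \sum_v M u v * x v.
Proof. by move=> ME e0 u; rewrite ME lerBrDr gerDl mulr_ge0_le0. Qed.

Lemma extremal_productE : (p - 1) * (r - 1) = 0 <-> #|P| = 1%N \/ #|Q| = 1%N.
Proof.
rewrite -pE1 -rE1; split=> [/eqP|[->|->]]; rewrite ?subrr ?mulr0 ?mul0r //.
by rewrite mulf_eq0 !subr_eq0 => /orP[/eqP->|/eqP->]; [left | right].
Qed.

Lemma rho_bound :
  let l := (n%:R - 2 + Num.sqrt ((n%:R - 2) ^+ 2 + 4 * k%:R)) / 2 in
  rho R G <= l /\
  (rho R G = l <-> G =2 cut_rel P Q /\ (#|P| = 1%N \/ #|Q| = 1%N)).
Proof.
set D := _ + 4 * _; move=> l.
(* This quadratic in [mu] is the defect for [p = 1] or [r = 1], where [p * r = n - k - 1]. Its value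
   at [n - r] is [- (p - 1) * (r - 1) - r * k]. *)
have [||mu_eq mu_gt] := @quadratic_root R n%:R (n%:R - k%:R - 1) D (n%:R - r).
- by rewrite /D; ring.
- by move: pr_ge0 rk_gt0 p1 r1; rewrite nE; lra.
set mu := (_ / 2) in mu_eq mu_gt.
have test := cut_mx_test PQ mu (-1); rewrite -/p -/r in test.
have lE : mu - 1 = l by rewrite /l /mu; field.
have eE : mu * (mu - n%:R) - (-1) * p * r = (p - 1) * (r - 1).
  by move: mu_eq; rewrite nE; lra.
rewrite eE lE in test.
have := spectral_radius_comparison_le n_gt0 adjacency_ge0
  adjacency_le_cut (test_vector_gt0 (cut_pairQ_gt0 cG) mu_gt)
  (connect_support (fun u v => lexx _)) (defect_le test pr_ge0).
by rewrite adjacency_eq_cut (defect_eq0 test) extremal_productE.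
Qed.

Lemma q_bound :
  let l := (2 * n%:R + k%:R - 3
            + Num.sqrt ((2 * n%:R - k%:R - 3) ^+ 2 + 4 * k%:R)) / 2 in
  q R G <= l /\ (q R G = l <-> G =2 cut_rel P Q /\ #|Q| = 1%N).
Proof.
set D := _ + 4 * _; move=> l.
(* The quadratic is the defect for [r = 1] and [p = n - k - 1]; at [n - 1] it takes the value
   [- k]. *)
have [||mu_eq mu_gt1] := @quadratic_root R (k%:R + 1)
    (- (n%:R - k%:R - 1) * (n%:R - 2)) D (n%:R - 1).
- by rewrite /D; ring.
- by move: kR1; lra.
set mu := (_ / 2) in mu_eq mu_gt1.
have mu_gt : n%:R - r < mu by move: r1; lra.
have mu_lt : mu < n%:R.
  rewrite ltNge; apply/negP => mun.
  have : 0 <= (mu - n%:R) * (mu + n%:R - k%:R - 1).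
    by apply: mulr_ge0; move: mun p1 r1 kR1; rewrite nE; lra.
  by move: mu_eq p1 r1; rewrite nE; lra.
have test := add_row_sums_cut_mx_test PQ mu (-1); rewrite -/p -/r in test.
have lE : mu + n%:R - 2 = l by rewrite /l /mu; field.
(* The cofactor of [r - 1] in the defect after reducing modulo the equation of [mu]; by [mu < n] it
   exceeds [2 * (p - 1)]. *)
pose c : R := 3 * n%:R - 2 * k%:R - 2 * r - 2 - mu.
have c0 : 0 < c by move: mu_lt p1; rewrite /c nE; lra.
have eE : mu * (mu - n%:R) - (-1) * p * (mu - n%:R + 2 * r) = (r - 1) * c.
  by move: mu_eq; rewrite /c nE; lra.
clearbody c.
rewrite eE lE in test.
have e_ge0 : 0 <= (r - 1) * c by rewrite mulr_ge0 ?subr_ge0 // ltW.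
have e_eq0 : (r - 1) * c = 0 <-> #|Q| = 1%N.
  rewrite -rE1; split=> [/eqP|->]; last by rewrite subrr mul0r.
  by rewrite mulf_eq0 (gt_eqF c0) orbF subr_eq0 => /eqP.
have Ale := add_row_sums_ge adjacency_ge0.
have := spectral_radius_comparison_le n_gt0
  (fun u v => le_trans (adjacency_ge0 u v) (Ale u v))
  (add_row_sums_le adjacency_le_cut)
  (test_vector_gt0 (cut_pairQ_gt0 cG) mu_gt)
  (connect_support Ale) (defect_le test e_ge0).
rewrite (defect_eq0 test) e_eq0 /q signless_laplacianE add_row_sums_inj.
- by rewrite adjacency_eq_cut.
- exact: adjacency_diag.
- exact: cut_mx_diag.
Qed.

Lemma cut_mx1_ge0 u v : 0 <= cut_mx P Q (1 : R) u v.
Proof. by rewrite cut_mx1 ler0n. Qed.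

Lemma rhoD_bound :
  let l := (n%:R - 2 + Num.sqrt ((n%:R + 2) ^+ 2 - 4 * k%:R - 8)) / 2 in
  l <= rhoD R G /\
  (rhoD R G = l <-> G =2 cut_rel P Q /\ (#|P| = 1%N \/ #|Q| = 1%N)).
Proof.
set D := _ - 8; move=> l.
(* Again the defect for [p = 1] or [r = 1], now with [s = 1]. *)
have [||mu_eq mu_gt] :=
  @quadratic_root R n%:R (- (n%:R - k%:R - 1)) D (n%:R - r).
- by rewrite /D; ring.
- by move: pr_ge0 rk_gt0 p1 r1; rewrite nE; lra.
set mu := (_ / 2) in mu_eq mu_gt.
have test := cut_mx_test PQ mu 1; rewrite -/p -/r in test.
have lE : mu - 1 = l by rewrite /l /mu; field.
have eE : mu * (mu - n%:R) - 1 * p * r = - ((p - 1) * (r - 1)).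
  by move: mu_eq; rewrite nE; lra.
rewrite eE lE in test.
have e_le0 : - ((p - 1) * (r - 1)) <= 0.
  by rewrite oppr_le0.
have := spectral_radius_comparison_ge n_gt0 cut_mx1_ge0 cut_le_distance
  (test_vector_gt0 (cut_pairQ_gt0 cG) mu_gt) distance_pos
  (defect_ge test e_le0).
have e_eq0 : - ((p - 1) * (r - 1)) = 0 <-> #|P| = 1%N \/ #|Q| = 1%N.
  by rewrite -extremal_productE; split=> [/(canRL opprK)|->]; rewrite ?oppr0.
by rewrite distance_eq_cut (defect_eq0 test) e_eq0.
Qed.

Lemma qD_bound :
  let l := (3 * n%:R - 3
            + Num.sqrt ((n%:R + 3) ^+ 2 - 8 * k%:R - 16)) / 2 in
  l <= qD R G /\ (qD R G = l <-> G =2 cut_rel P Q /\ #|P| = 1%N).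
Proof.
set D := _ - 16; move=> l.
(* The quadratic is the defect for [p = 1] and [r = n - k - 1]; at [n] it takes the value
   [- 2 * (n - k - 1)]. *)
have [||mu_eq mu_gtn] :=
  @quadratic_root R (n%:R + 1) (2 * k%:R + 2 - n%:R) D n%:R.
- by rewrite /D; ring.
- by move: p1 r1; rewrite nE; lra.
set mu := (_ / 2) in mu_eq mu_gtn.
have mu_gt : n%:R - r < mu by move: r1; lra.
have test := add_row_sums_cut_mx_test PQ mu 1; rewrite -/p -/r in test.
have lE : mu + n%:R - 2 = l by rewrite /l /mu; field.
(* Up to sign the cofactor of [p - 1] in the reduced defect; by [n < mu] it exceeds
   [2 * (r - 1)]. *)
pose c : R := mu + n%:R - 2 * p - 2 * k%:R - 2.
have c0 : 0 < c by move: mu_gtn r1; rewrite /c nE; lra.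
have eE : mu * (mu - n%:R) - 1 * p * (mu - n%:R + 2 * r) = - ((p - 1) * c).
  by move: mu_eq; rewrite /c nE; lra.
clearbody c.
rewrite eE lE in test.
have e_le0 : - ((p - 1) * c) <= 0.
  by rewrite oppr_le0 mulr_ge0 ?subr_ge0 // ltW.
have e_eq0 : - ((p - 1) * c) = 0 <-> #|P| = 1%N.
  rewrite -pE1; split=> [/eqP|->]; last by rewrite subrr mul0r oppr0.
  by rewrite oppr_eq0 mulf_eq0 (gt_eqF c0) orbF subr_eq0 => /eqP.
have Nle := add_row_sums_ge cut_mx1_ge0.
have := spectral_radius_comparison_ge n_gt0
  (fun u v => le_trans (cut_mx1_ge0 u v) (Nle u v))
  (add_row_sums_le cut_le_distance)
  (test_vector_gt0 (cut_pairQ_gt0 cG) mu_gt)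
  (* Off the diagonal the entries are distances, hence positive. *)
  (fun u v (uv : u != v) => eq_ind_r (<%R 0) (distance_pos uv)
     (add_row_sums_offdiag _ uv))
  (defect_ge test e_le0).
rewrite (defect_eq0 test) e_eq0 add_row_sums_inj.
- by rewrite distance_eq_cut.
- exact: distance_diag.
- exact: cut_mx_diag.
Qed.

End Comparison.

(** * From cut pairs to the extremal digraphs up to isomorphism *)

Lemma iso_K_cut_pair (n k p : nat) (G : digraph 'I_n) :
  (0 < p)%N -> (p + k < n)%N ->
  digraph_iso G (K n k p) <->
  exists P Q, [/\ cut_pair k G P Q, G =2 cut_rel P Q, #|P| = p &
                  #|Q| = (n - p - k)%N].
Proof.
move=> p0 pkn; rewrite iso_K_cut; last exact: ltnW.
split=> [[P [Q [PQ cardP cardQ GE]]]|[P [Q [[PQ _ _ _ _] GE cardP cardQ]]]].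
  exists P, Q; split=> //; split=> //; try lia.
  by move=> u v; rewrite GE.
by exists P, Q.
Qed.

Unset Implicit Arguments.

Theorem theorem4p1 (R : realType) (n k : nat) (G : digraph 'I_n) :
  (1 <= k)%N -> (k <= n - 2)%N -> Omega k G ->
  [/\ rho R G <= (n%:R - 2 + Num.sqrt ((n%:R - 2) ^+ 2 + 4 * k%:R)) / 2
      /\ (rho R G = (n%:R - 2 + Num.sqrt ((n%:R - 2) ^+ 2 + 4 * k%:R)) / 2
          <-> digraph_iso G (K n k 1) \/ digraph_iso G (K n k (n - k - 1))),
      q R G <= (2 * n%:R + k%:R - 3
                + Num.sqrt ((2 * n%:R - k%:R - 3) ^+ 2 + 4 * k%:R)) / 2
      /\ (q R G = (2 * n%:R + k%:R - 3
                   + Num.sqrt ((2 * n%:R - k%:R - 3) ^+ 2 + 4 * k%:R)) / 2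
          <-> digraph_iso G (K n k (n - k - 1))),
      (n%:R - 2 + Num.sqrt ((n%:R + 2) ^+ 2 - 4 * k%:R - 8)) / 2 <= rhoD R G
      /\ (rhoD R G = (n%:R - 2 + Num.sqrt ((n%:R + 2) ^+ 2 - 4 * k%:R - 8)) / 2
          <-> digraph_iso G (K n k 1) \/ digraph_iso G (K n k (n - k - 1)))
    & (3 * n%:R - 3 + Num.sqrt ((n%:R + 3) ^+ 2 - 8 * k%:R - 16)) / 2 <= qD R G
      /\ (qD R G = (3 * n%:R - 3
                    + Num.sqrt ((n%:R + 3) ^+ 2 - 8 * k%:R - 16)) / 2
          <-> digraph_iso G (K n k 1))].
Proof.
move=> k1 kn OG; have [P [Q cG]] := Omega_cut_pair k1 kn OG.
have /andP[sG _] := OG; have cardPQ := cut_pair_card cG.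
have isoP : digraph_iso G (K n k 1) <->
    exists P Q, [/\ cut_pair k G P Q, G =2 cut_rel P Q & #|P| = 1%N].
  rewrite iso_K_cut_pair; [|lia..]; split=> [[P' [Q' [cG' ?? _]]]|].
    by exists P', Q'.
  move=> [P' [Q' [cG' GE P1]]]; exists P', Q'; split=> //.
  by have := cut_pair_card cG'; lia.
have isoQ : digraph_iso G (K n k (n - k - 1)) <->
    exists P Q, [/\ cut_pair k G P Q, G =2 cut_rel P Q & #|Q| = 1%N].
  rewrite iso_K_cut_pair; [|lia..]; split=> [[P' [Q' [cG' ?? Q1]]]|].
    by exists P', Q'; split=> //; rewrite Q1; lia.
  by move=> [P' [Q' [cG' GE Q1]]]; exists P', Q'; split=> //;
    have := cut_pair_card cG'; lia.
have isoPQ : digraph_iso G (K n k 1) \/ digraph_iso G (K n k (n - k - 1)) <->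
    exists P Q, [/\ cut_pair k G P Q, G =2 cut_rel P Q &
                    #|P| = 1%N \/ #|Q| = 1%N].
  rewrite isoP isoQ; split=> [[]|] [P' [Q' [cG' GE]]] => [?|?|].
  - by exists P', Q'; split=> //; left.
  - by exists P', Q'; split=> //; right.
  - by case=> ?; [left | right]; exists P', Q'.
split.
- have [le_l eq_l] := rho_bound R sG k1 cG; split=> //; rewrite isoPQ; split.
    by rewrite eq_l => -[]; exists P, Q.
  (* The isomorphism may provide another cut pair than the one chosen at the start, so the bound is
     applied afresh to that pair; likewise in the other three parts. *)
  by case=> P' [Q' [cG' *]]; apply/(rho_bound R sG k1 cG').2.
- have [le_l eq_l] := q_bound R sG k1 cG; split=> //; rewrite isoQ; split.
    by rewrite eq_l => -[]; exists P, Q.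
  by case=> P' [Q' [cG' *]]; apply/(q_bound R sG k1 cG').2.
- have [le_l eq_l] := rhoD_bound R sG k1 cG; split=> //; rewrite isoPQ; split.
    by rewrite eq_l => -[]; exists P, Q.
  by case=> P' [Q' [cG' *]]; apply/(rhoD_bound R sG k1 cG').2.
- have [le_l eq_l] := qD_bound R sG k1 cG; split=> //; rewrite isoP; split.
    by rewrite eq_l => -[]; exists P, Q.
  by case=> P' [Q' [cG' *]]; apply/(qD_bound R sG k1 cG').2.
Qed.
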